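(* For every positive integer $n$, $f(n)\geq \lfloor n/2\rfloor$; that is, there exists a permutation of $[n]$ that cannot be transformed into the identity permutation $[1\,2\,\cdots\,n]$ using fewer than $\lfloor n/2\rfloor$ cut-and-paste moves.
   Context: Let $[n]=\{1,\ldots,n\}$ and write a permutation of $[n]$ as a string $\pi_1\pi_2\cdots\pi_n$. A cut-and-paste move consists of cutting a (contiguous) substring out of the permutation, optionally reversing it, and then pasting it back into the remaining string at any position. Define $f(n)$ to be the maximum, over all permutations $\pi$ of $[n]$, of the minimum number of cut-and-paste moves needed to transform $\pi$ into the identity permutation $[1\,2\,\cdots\,n]$. *)

(* Defs.v *)
From mathcomp Require Import all_boot all_fingroup.

Set Implicit Arguments.
Unset Strict Implicit.
Unset Printing Implicit Defensive.

(* Cut the block of [l] letters starting at 0-based position [i] out of [s],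
   reverse it if [r], and paste it back before position [j] of what remains.
   Indices running past the end are truncated by [take] and [drop], and such
   moves coincide with moves with indices in range. *)
Definition cut_paste (T : Type) (i l j : nat) (r : bool) (s : seq T) : seq T :=
  let block := take l (drop i s) in
  let rest := take i s ++ drop (i + l) s in
  take j rest ++ (if r then rev block else block) ++ drop j rest.

Fixpoint cut_paste_in (T : eqType) (k : nat) (s t : seq T) : bool :=
  if k is k'.+1 then
    [exists i : 'I_(size s).+1, exists l : 'I_(size s).+1,
     exists j : 'I_(size s).+1, exists r : bool,
       cut_paste_in k' (cut_paste i l j r s) t]
  else s == t.

Lemma cut_pasteP (T : Type) (s t : seq T) :
  (exists i l j r,
     [/\ i < (size s).+1, l < (size s).+1, j < (size s).+1
       & t = cut_paste i l j r s]) <->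
  (exists a b c u v,
     [/\ s = a ++ b ++ c, a ++ c = u ++ v
       & t = u ++ b ++ v \/ t = u ++ rev b ++ v]).
Proof.
split.
  move=> [i [l [j [r [_ _ _ ->]]]]].
  exists (take i s), (take l (drop i s)), (drop (i + l) s).
  exists (take j (take i s ++ drop (i + l) s)).
  exists (drop j (take i s ++ drop (i + l) s)).
  split; last by rewrite /cut_paste; case: r; [right | left].
    by rewrite addnC -drop_drop !cat_take_drop.
  by rewrite cat_take_drop.
move=> [a [b [c [u [v [-> eq_rest eq_t]]]]]].
have szr : size u + size v = size a + size c by rewrite -!size_cat eq_rest.
have cpE r : cut_paste (size a) (size b) (size u) r (a ++ b ++ c)
    = u ++ (if r then rev b else b) ++ v.
  rewrite /cut_paste (@drop_size_cat _ (size a) a) //.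
  rewrite (@take_size_cat _ (size a) a) // (@take_size_cat _ (size b) b) //.
  rewrite (catA a b c) -size_cat (@drop_size_cat _ _ (a ++ b)) // eq_rest.
  by rewrite take_size_cat // drop_size_cat.
have leb : size b <= size a + (size b + size c).
  by rewrite addnCA leq_addr.
have leu : size u <= size a + (size b + size c).
  by rewrite addnCA -szr addnCA leq_addr.
exists (size a), (size b), (size u).
by case: eq_t => ->; [exists false | exists true];
  rewrite cpE !size_cat !ltnS leq_addr leb leu.
Qed.

Lemma cut_paste_in_cons (T : eqType) (x : T) k s t :
  cut_paste_in k s t -> cut_paste_in k (x :: s) (x :: t).
Proof.
elim: k s => [|k IHk] s /=; first by move/eqP->.
case/existsP=> i /existsP[l] /existsP[j] /existsP[r] Hr.
apply/existsP; exists (lift ord0 i); apply/existsP.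
exists (widen_ord (leqnSn _) l); apply/existsP; exists (lift ord0 j).
by apply/existsP; exists r; rewrite /= /bump /cut_paste /=; apply: IHk.
Qed.

Lemma cut_paste_in_total (T : eqType) (s t : seq T) :
  perm_eq s t -> exists k, cut_paste_in k s t.
Proof.
elim: t s => [|x t IHt] s; first by move/perm_nilP->; exists 0; apply/eqP.
move=> eq_st; have: x \in s by rewrite (perm_mem eq_st) mem_head.
case/splitPr def_s: s / => [a c]; rewrite {}def_s in eq_st.
have [|k Hk] := IHt (a ++ c).
  by rewrite -(perm_cons x) -(permPr eq_st) -cat1s perm_catCA.
exists k.+1 => /=.
have [i [l [j [r [Hi Hl Hj Et]]]]] :=
  (cut_pasteP (a ++ x :: c) (x :: a ++ c)).2 (ex_intro _ a (ex_intro _ [:: x]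
   (ex_intro _ c (ex_intro _ [::] (ex_intro _ (a ++ c)
   (And3 erefl erefl (or_introl erefl))))))).
apply/existsP; exists (Ordinal Hi); apply/existsP; exists (Ordinal Hl).
apply/existsP; exists (Ordinal Hj); apply/existsP; exists r.
by rewrite -Et; apply: cut_paste_in_cons.
Qed.

(* The string pi_1 ... pi_n, shifted from {0, ..., n-1} to {1, ..., n}. *)
Definition word (n : nat) (p : 'S_n) : seq nat :=
  [seq (p i).+1 | i <- enum 'I_n].

Definition id_word (n : nat) : seq nat := iota 1 n.

Lemma word1 n : word (1%g : 'S_n) = id_word n.
Proof.
rewrite /word /id_word (eq_map (g := succn \o val)); last by move=> i; rewrite perm1.
by rewrite map_comp val_enum_ord -(addn0 1) iotaDl.
Qed.

Lemma perm_word n (p : 'S_n) : perm_eq (word p) (id_word n).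
Proof.
rewrite -word1 /word; apply: uniq_perm.
- by rewrite map_inj_uniq ?enum_uniq // => i j [] /val_inj /perm_inj.
- by rewrite map_inj_uniq ?enum_uniq // => i j [] /val_inj /perm_inj.
move=> m; apply/mapP/mapP => -[i _ ->]; rewrite ?perm1.
  by exists (p i); rewrite ?mem_enum ?perm1.
by exists ((p^-1)%g i); rewrite ?mem_enum ?permKV.
Qed.

Definition sorting_number (n : nat) (p : 'S_n) : nat :=
  ex_minn (cut_paste_in_total (perm_word p)).

Definition f (n : nat) : nat := \max_(p : 'S_n) sorting_number p.

(* Main.v *)
Require Import Defs.
From mathcomp Require Import all_boot all_fingroup.
From mathcomp Require Import zify.

(** Colour each letter by its parity, frame the string by 0 and n+1, and count
    the adjacent pairs of letters of opposite parity. A move breaks three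
    adjacencies and creates three new ones. It cannot gain all three: the broken
    pairs would be monochromatic, of colours x, y, z say, and the new pairs would
    force x, y, z to be pairwise distinct, although there are only two colours.
    So a move gains at most 2. The string listing the even letters and then the
    odd ones has 1 + (n mod 2) such pairs, the identity has n + 1, and hence at
    least floor(n/2) moves are needed. *)

Set Implicit Arguments.
Unset Strict Implicit.
Unset Printing Implicit Defensive.

(** The colour [x] is that of the letter just before [s], so the left frame is an argument and not
    part of the list. *)
Fixpoint color_changes (x : bool) (s : seq bool) : nat :=
  if s is y :: s' then (x (+) y) + color_changes y s' else 0.

Lemma color_changes_cat x s t :
  color_changes x (s ++ t) = color_changes x s + color_changes (last x s) t.
Proof. by elim: s x => //= y s IHs x; rewrite IHs addnA. Qed.

Lemma color_changes_rev_cat x y s t :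
  color_changes x (rev (y :: s) ++ t) =
  (x (+) last y s) + color_changes y s + color_changes y t.
Proof.
elim: s y t => [|z s IHs] y t; first by rewrite /rev /= addn0.
by rewrite rev_cons cat_rcons IHs /= addbC; lia.
Qed.

Lemma color_changes_block (r : bool) x y s t :
  color_changes x ((if r then rev (y :: s) else y :: s) ++ t) =
  (x (+) (if r then last y s else y)) + color_changes y s
  + color_changes (if r then y else last y s) t.
Proof. by case: r; rewrite ?color_changes_rev_cat //= color_changes_cat addnA. Qed.

(** Changes inside [b], [w] and [d] survive the move, even under reversal, so only the junctions
    between the blocks can differ. *)
Lemma color_changes_move_left (r : bool) x b w d :
  color_changes x ((if r then rev b else b) ++ w ++ d)
    <= color_changes x (w ++ b ++ d) + 2.
Proof.
case: b => [|y b]; first by rewrite if_same leq_addr.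
rewrite color_changes_block !color_changes_cat /=.
(* A finite check over the colours at the ends of the blocks; an empty [w] or [d] has fewer
   junctions. *)
by case: r x y (last y b) w d => [] [] [] [] [|[] w] [|[] d] /=;
  try case: (last _ w) => /=; lia.
Qed.

Lemma color_changes_move_right (r : bool) x b w d :
  color_changes x (w ++ (if r then rev b else b) ++ d)
    <= color_changes x (b ++ w ++ d) + 2.
Proof.
case: b => [|y b]; first by rewrite if_same leq_addr.
rewrite color_changes_cat color_changes_block /= !color_changes_cat.
by case: r x y (last y b) w d => [] [] [] [] [|[] w] [|[] d] /=;
  try case: (last _ w) => /=; lia.
Qed.

(** Decides whether the block is pasted to the left or to the right of where it was cut. *)
Lemma cat_eq_cat (T : Type) (a c u v : seq T) :
  a ++ c = u ++ v ->
  (exists2 w, a = u ++ w & v = w ++ c) \/ (exists2 w, u = a ++ w & c = w ++ v).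
Proof.
elim: a u => [|x a IHa] [|y u] /=.
- by move=> ->; left; exists [::].
- by move=> ->; right; exists (y :: u).
- by move=> <-; left; exists (x :: a).
case=> -> /IHa[] [w -> ->]; first by left; exists w.
by right; exists w.
Qed.

Definition parity_changes (e : bool) (s : seq nat) : nat :=
  color_changes false (map odd s ++ [:: e]).

Lemma parity_changes_cut_paste e i l j r s :
  i <= size s -> l <= size s -> j <= size s ->
  parity_changes e (cut_paste i l j r s) <= parity_changes e s + 2.
Proof.
move=> lei lel lej.
have [|a [b [c [u [v [eq_s eq_rest eq_t]]]]]] :=
  (cut_pasteP s (cut_paste i l j r s)).1 _.
  by exists i, l, j, r.
have {eq_t}[q ->]: exists q : bool,
    cut_paste i l j r s = u ++ (if q then rev b else b) ++ v.
  by case: eq_t => ->; [exists false | exists true].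
rewrite {}eq_s /parity_changes !map_cat (fun_if (map odd)) map_rev -!catA.
case: (cat_eq_cat eq_rest) => -[w -> ->]; rewrite !map_cat -!catA.
  (* The common prefix cancels; the block just jumps over [w]. *)
  by rewrite !(color_changes_cat _ (map odd u)) -addnA leq_add2l
    color_changes_move_left.
by rewrite !(color_changes_cat _ (map odd a)) -addnA leq_add2l
  color_changes_move_right.
Qed.

Lemma parity_changes_cut_paste_in e k s t :
  cut_paste_in k s t -> parity_changes e t <= parity_changes e s + k.*2.
Proof.
elim: k s => [|k IHk] s /=; first by move/eqP->; rewrite addn0.
case/existsP=> i /existsP[l] /existsP[j] /existsP[r] /IHk le_t.
have := @parity_changes_cut_paste e i l j r s
  (leq_ord i) (leq_ord l) (leq_ord j).
by lia.
Qed.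

Lemma parity_changes_id_word n : parity_changes (odd n.+1) (id_word n) = n.+1.
Proof.
rewrite /parity_changes /id_word.
have -> : map odd (iota 1 n) ++ [:: odd n.+1] = map odd (iota 1 n.+1).
  by rewrite -[in RHS](addn1 n) iotaD map_cat.
(* The left frame is read as the letter 0, then generalized to any [m]. *)
rewrite -[false]/(odd 0); elim: n.+1 0 => //= k IHk m.
by rewrite -[~~ odd m]/(odd m.+1) IHk /=; case: (odd m).
Qed.

Definition evens_odds (n : nat) : seq nat :=
  filter (predC odd) (iota 1 n) ++ filter odd (iota 1 n).

Lemma parity_changes_evens_odds n :
  parity_changes (odd n.+1) (evens_odds n) <= (odd n).+1.
Proof.
have map_evens s : map odd (filter (predC odd) s) = nseq (count (predC odd) s) false.
  by elim: s => //= x s IHs; case: ifP => //= /negbTE ->; rewrite IHs.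
have map_odds s : map odd (filter odd s) = nseq (count odd s) true.
  by elim: s => //= x s IHs; case: ifP => //= ->; rewrite IHs.
rewrite /parity_changes map_cat map_evens map_odds -catA.
elim: (count (predC odd) _) => [|? //] /=; case: (count odd _) => [|m] /=.
  by case: (odd n).
by elim: m => //=; case: (odd n).
Qed.

Lemma word_surj n (s : seq nat) :
  perm_eq s (id_word n) -> exists p : 'S_n, word p = s.
Proof.
rewrite -word1.
have sz1 : size (word (1%g : 'S_n)) == n by rewrite size_map size_enum_ord.
move=> /(@tuple_permP _ _ s (Tuple sz1)) [p ->]; exists p.
rewrite /word /=; apply: eq_map => i.
by rewrite (tnth_nth 0) /= (nth_map i) ?size_enum_ord // nth_ord_enum perm1.
Qed.

Lemma half_le_moves n (p : 'S_n) k :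
  word p = evens_odds n -> cut_paste_in k (word p) (id_word n) -> n./2 <= k.
Proof.
move=> -> /(@parity_changes_cut_paste_in (odd n.+1)).
(* This amounts to [n.+1 <= (odd n).+1 + k.*2], where [n - odd n] is twice [n./2]. *)
by rewrite parity_changes_id_word; have := parity_changes_evens_odds n; lia.
Qed.

Theorem mainTheorem1 (n : nat) (n_gt0 : 0 < n) :
  n./2 <= f n /\
  exists p : 'S_n,
    forall k : nat, k < n./2 -> ~ cut_paste_in k (word p) (id_word n).
Proof.
have [|p eq_p] := @word_surj n (evens_odds n).
  by rewrite /evens_odds perm_catC perm_filterC.
split; last first.
  by exists p => k lt_k /(half_le_moves eq_p); rewrite leqNgt lt_k.
apply: leq_trans (leq_bigmax p); rewrite /sorting_number.
by case: ex_minnP => k /(half_le_moves eq_p).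
Qed.
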